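(* For $x,y\in\{0,1,\ldots,q-1\}^d$: (i) In general, $$(1-\alpha)G(x,y;\alpha)=\frac{1}{q^d}\sum_{r\in\{0,\ldots,q-1\}^d}\frac{1}{1+\frac{\alpha}{1-\alpha}(1-\rho_r)}\;\theta_1^{(x-y)\cdot r}.$$ (ii) If the entries of $V$ are exchangeable, then also $$(1-\alpha)G(x,y;\alpha)=\frac{1}{q^d}\Bigg\{1+\sum_{l\,:\,0<|l|\le d}\frac{h_l}{1+\frac{\alpha}{1-\alpha}(1-\kappa_l)}\,Q_l(m;(\theta_k))\,\overline{Q_l(n;(\theta_k))}\Bigg\},$$ where $m,n$ are the grouped values in $x,y$, that is, $m[j]=|\{k:x[k]=j\}|$ and $n[j]=|\{k:y[k]=j\}|$ for $j=0,\ldots,q-1$.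
   Context: Let $q\ge 2$, $d\ge 1$ be integers, $\alpha\in(0,1)$, and let $V$ be a random variable with values in $\{0,1,\ldots,q-1\}^d$. The random walk is $X_{t+1}=X_t+Z_t \bmod q$ (entrywise), $t=0,1,2,\ldots$, with $(Z_t)$ i.i.d. distributed as $V$ and independent of $X_0$. The Green function with killing probability $1-\alpha$ at each transition is $G(x,y;\alpha)=\sum_{t=0}^\infty\alpha^t\,\mathbb{P}(X_t=y\mid X_0=x)$. Notation: $\theta_k=e^{2\pi i k/q}$, $u\cdot r=\sum_{j=1}^d u[j]r[j]$, and $\rho_r=\mathbb{E}[\theta_1^{V\cdot r}]$ for $r\in\{0,\ldots,q-1\}^d$. The index $l=(l[1],\ldots,l[q-1])$ ranges over vectors of nonnegative integers and $|l|=l[1]+\cdots+l[q-1]$. For a vector $m=(m[0],\ldots,m[q-1])$ of nonnegative integers summing to $d$, the multivariate Krawtchouk polynomial $Q_l(m;(\theta_k))$ is the coefficient of $w_1^{l[1]}\cdots w_{q-1}^{l[q-1]}$ in $$\prod_{j=0}^{q-1}\Big(1+\sum_{k=1}^{q-1}w_k\theta_k^j\Big)^{m[j]},$$ and $h_l^{-1}=\dfrac{d!}{(d-|l|)!\,l[1]!\cdots l[q-1]!}$. When the entries of $V$ are exchangeable, $\kappa_l$ denotes the common value of $\rho_r$ over all $r\in\{0,\ldots,q-1\}^d$ having exactly $l[j]$ entries equal to $j$ for each $j=1,\ldots,q-1$ (the remaining $d-|l|$ entries being $0$).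
   Formalization: In (ii), G(x,y;α) is replaced by its mean over all y' with the same grouped values n as y; as written (ii) fails, e.g. V=0, q=d=2, x=(0,1), y=(1,0), where G(x,x)≠G(x,y) but the right side is the same for both. *)

(* Defs.v *)
From HB Require Import structures.
From mathcomp Require Import all_boot all_order all_algebra all_fingroup.
From mathcomp Require Import complex.
From mathcomp Require mpoly.

Set Implicit Arguments.
Unset Strict Implicit.
Unset Printing Implicit Defensive.

Import Order.TTheory GRing.Theory Num.Theory.

(* An index l = (l[1], ..., l[q-1]) with |l| <= d is encoded with a shift: the
   coordinate l[k] is [l k'] for the k' : 'I_q.-1 such that k = k'.+1.  Bounding
   each coordinate by d loses nothing, since l[k] <= |l| <= d. *)
Notation lindex q d := {ffun 'I_q.-1 -> 'I_d.+1}.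

Definition index_norm q d (l : lindex q d) : nat := (\sum_k l k)%N.

(* The multivariate Krawtchouk polynomial, for a sequence theta of weights: the
   indeterminate w_k is 'X_k', with the same shift k = k'.+1.  The modules of
   multinomials are imported locally only, as their notations conflict with those
   of the analysis library. *)
Module Krawtchouk.
Import mpoly.
Local Open Scope ring_scope.

Definition krawtchouk (C : comNzRingType) (theta : nat -> C) q d
    (l : lindex q d) (m : 'I_q -> nat) : C :=
  (\prod_(j < q)
     (1 + \sum_(k < q.-1) (theta k.+1 ^+ j)%:MP * 'X_k) ^+ m j
   : {mpoly C[q.-1]})@_[multinom (l k : nat) | k < q.-1].

End Krawtchouk.
Export Krawtchouk.

From mathcomp Require Import all_classical all_reals all_analysis.
Import numFieldNormedType.Exports.

Local Open Scope classical_set_scope.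
Local Open Scope ring_scope.

Notation state q d := {ffun 'I_d -> 'I_q}.

Section RandomWalk.
Context {d0 : measure_display} {Omega : measurableType d0} {R : realType}.
Variable P : probability Omega R.

(* Measurability of a map into a finite type carrying the discrete
   sigma-algebra. *)
Definition finite_rv (S : finType) (Y : Omega -> S) : Prop :=
  forall s, measurable (Y @^-1` [set s]).

Definition mutually_independent (S : finType) (Z : nat -> Omega -> S) : Prop :=
  forall (J : seq nat) (A : nat -> {set S}), uniq J ->
    P (\bigcap_(j in [set` J]) Z j @^-1` [set` A j])
    = (\prod_(j <- J) P (Z j @^-1` [set` A j]))%E.

(* The events below, with J finite, form a pi-system generating the
   sigma-algebra of the whole sequence Z. *)
Definition independent_of_sequence (S S' : finType)
    (Y : Omega -> S) (Z : nat -> Omega -> S') : Prop :=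
  forall (B : {set S}) (J : seq nat) (A : nat -> {set S'}),
    P (Y @^-1` [set` B] `&` \bigcap_(j in [set` J]) Z j @^-1` [set` A j])
    = (P (Y @^-1` [set` B]) *
       P (\bigcap_(j in [set` J]) Z j @^-1` [set` A j]))%E.

Definition cond_prob (A B : set Omega) : R := fine (P (A `&` B)) / fine (P B).

Definition green (S : finType) (X : nat -> Omega -> S) (alpha : R) (x y : S) : R :=
  limn (series (fun t : nat =>
    alpha ^+ t * cond_prob (X t @^-1` [set y]) (X 0%N @^-1` [set x]))).

End RandomWalk.

Record random_walk {dV d0 : measure_display}
    {OmegaV : measurableType dV} {Omega : measurableType d0} {R : realType}
    (PV : probability OmegaV R) (P : probability Omega R) (q d : nat)
    (V : OmegaV -> state q d) (X Z : nat -> Omega -> state q d) : Prop :=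
  RandomWalk {
    walk_start_rv : finite_rv (X 0%N) ;
    walk_step_rv : forall t, finite_rv (Z t) ;
    walk_step_law : forall t v, P (Z t @^-1` [set v]) = PV (V @^-1` [set v]) ;
    walk_step_indep : mutually_independent P Z ;
    walk_start_indep : independent_of_sequence P (X 0%N) Z ;
    walk_stepE : forall t w k,
      X t.+1 w k = ((X t w k + Z t w k) %% q)%N :> nat }.

Definition permute q d (s : 'S_d) (x : state q d) : state q d :=
  [ffun k => x (s k)].

Definition exchangeable_entries {dV : measure_display}
    {OmegaV : measurableType dV} {R : realType} (PV : probability OmegaV R)
    q d (V : OmegaV -> state q d) : Prop :=
  forall (s : 'S_d) v,
    PV ((permute s \o V) @^-1` [set v]) = PV (V @^-1` [set v]).

Definition theta (R : realType) (q k : nat) : R[i] :=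
  let a : R := 2 * pi * k%:R / q%:R in (cos a +i* sin a)%C.

Definition dotn q d (u r : state q d) : nat := (\sum_j u j * r j)%N.

Definition dot_diff q d (x y r : state q d) : int :=
  \sum_j ((x j : int) - (y j : int)) * (r j : int).

Definition complex_expectation {dV : measure_display}
    {OmegaV : measurableType dV} {R : realType} (PV : probability OmegaV R)
    (Y : OmegaV -> R[i]) : R[i] :=
  (fine ('E_PV[fun w => complex.Re (Y w)])%E
   +i* fine ('E_PV[fun w => complex.Im (Y w)])%E)%C.

Definition rho {dV : measure_display} {OmegaV : measurableType dV}
    {R : realType} (PV : probability OmegaV R) q d (V : OmegaV -> state q d)
    (r : state q d) : R[i] :=
  complex_expectation PV (fun w => theta R q 1 ^+ dotn (V w) r).

Definition grouped q d (x : state q d) : {ffun 'I_q -> nat} :=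
  [ffun j => #|[set k | x k == j]%SET|].

Definition has_index q d (l : lindex q d) (r : state q d) : bool :=
  [forall k : 'I_q.-1, #|[set i | (r i == k.+1 :> nat)]%SET| == l k].

(* The value of rho at some r with index l.  Such an r exists if |l| <= d, and
   its choice is immaterial if the entries of V are exchangeable. *)
Definition kappa {dV : measure_display} {OmegaV : measurableType dV}
    {R : realType} (PV : probability OmegaV R) q d (V : OmegaV -> state q d)
    (l : lindex q d) : R[i] :=
  if [pick r | has_index l r] is Some r then rho PV V r else 0.

Definition hinv (C : fieldType) q d (l : lindex q d) : C :=
  (d`!)%:R / (((d - index_norm l)`! * \prod_k (l k)`!)%N)%:R.

Definition h (C : fieldType) q d (l : lindex q d) : C := (hinv C l)^-1.

(* The mean of green x over the arrangements y' of the entries of y, that is,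
   the Green function of the walk observed through its grouped values,
     sum_t alpha^t P(grouped (X_t) = n | X_0 = x)   with n = grouped y,
   divided by the number d!/(n[0]! ... n[q-1]!) of states with grouped value n.
   This is what a formula in the grouped values can express: green x itself is
   not a function of grouped y, even for exchangeable entries (take V = 0). *)
Definition grouped_green {d0 : measure_display} {Omega : measurableType d0}
    {R : realType} (P : probability Omega R) q d
    (X : nat -> Omega -> state q d) (alpha : R) (x y : state q d) : R :=
  (\sum_(y' : state q d | grouped y' == grouped y) green P X alpha x y')
  / #|[set y' : state q d | grouped y' == grouped y]%SET|%:R.

(* Main.v *)
From HB Require Import structures.
Require Import Defs.
From mathcomp Require Import all_boot all_order all_algebra all_fingroup.
From mathcomp Require Import complex.
From mathcomp Require mpoly.

(** The states form the group [(Z/q)^d], and [character x r = theta_1 ^ (x . r)]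
    lists its characters.  They are eigenfunctions of the walk: adding a step
    multiplies [character _ r] by a factor of mean [rho_r].

    General formula.  Conditioning on the last transition shows that the Green
    function satisfies the renewal equation
      [G(x,y) = 1_(x=y) + alpha * E[G(x, y - V)]]  ([green_renewal]).
    Pairing it with [character _ r] turns the convolution into a product:
      [(1 - alpha rho_r) * sum_y G(x,y) character y r = character x r]
    ([green_fourier]).  As [|rho_r| <= 1] and [alpha < 1], the factor is
    invertible, and Fourier inversion ([fourier_inversion], from orthogonality of
    the characters) gives the formula, because
      [(1 - alpha) / (1 - alpha rho) = 1 / (1 + alpha / (1 - alpha) (1 - rho))].
    Since the Fourier transform is applied to the limit, only real series are
    summed.  The probabilistic input is that the conditional law of [X_t]
    obeys the recursion of a Markov chain ([cond_prob_dynamics]).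

    Exchangeable entries.  Expanding the generating product shows that [Q_l(grouped x)] is the
    sum of [character x r] over all [r] of index [l] ([krawtchouk_character]).
    Exchangeability makes [rho_r] a function of the index of [r], so in the
    general formula the sum over [r] can be grouped by index.  The average of [character y' r] over the
    rearrangements [y'] of [y] equals [h_l Q_l(grouped y)]: this is a double
    count of the pairs [(y', r')] with [y'] a rearrangement of [y] and [r'] of
    index [l] ([sum_character_grouped]), [1 / h_l] being the number of such [r']
    ([hinv_card]). *)

Set Implicit Arguments.
Unset Strict Implicit.
Unset Printing Implicit Defensive.

Import Order.TTheory GRing.Theory Num.Theory.

(** * Krawtchouk polynomials as sums over states *)

Module KrawtchoukTheory.
Import mpoly.
Local Open Scope ring_scope.

(** The exponent of the monomial that records one entry equal to [k]; the value
    [0] is not recorded. *)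
Definition letter_exponent q (k : 'I_q.+1) : 'X_{1..q} :=
  [multinom (k == i.+1 :> nat) : nat | i < q].

Lemma linear_factorE (C : comNzRingType) (c : nat -> C) q : c 0%N = 1 ->
  1 + \sum_(k < q) (c k.+1)%:MP * 'X_k
    = \sum_(k < q.+1) (c k)%:MP * 'X_[letter_exponent k] :> {mpoly C[q]}.
Proof.
move=> c0; rewrite big_ord_recl /= c0; congr (_ + _).
by rewrite (_ : letter_exponent _ = 0%MM) ?mpolyX0 ?mulr1.
Qed.

Lemma prod_grouped (C : comNzRingType) q d (x : state q d) (F : 'I_q -> C) :
  \prod_(j < q) F j ^+ grouped x j = \prod_(i < d) F (x i).
Proof.
rewrite (partition_big x xpredT) //=; apply: eq_bigr => j _.
rewrite ffunE -prodr_const; apply: eq_big => i; first by rewrite inE.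
by rewrite inE => /eqP ->.
Qed.

(** Grouping equal entries of [x] turns the defining product into one factor per
    coordinate; choosing a term in each factor is choosing a state [r], whose
    monomial has the exponent [l] exactly if [r] has index [l].  The constant term
    of a factor is the choice [r i = 0], whence the condition on [th 0]. *)
Lemma krawtchoukE (C : comNzRingType) (th : nat -> C) q d
    (l : lindex q.+1 d) (x : state q.+1 d) : th 0%N = 1 ->
  krawtchouk th l (grouped x)
    = \sum_(r : state q.+1 d | has_index l r) \prod_i th (r i) ^+ x i.
Proof.
move=> th0; rewrite /krawtchouk prod_grouped.
under eq_bigr do rewrite (linear_factorE (c := fun k => th k ^+ _)) ?th0 ?expr1n //.
rewrite bigA_distr_bigA raddf_sum /= [RHS]big_mkcond; apply: eq_bigr => r _.
rewrite big_split /= -rmorph_prod -(big_morph _ (@mpolyXD q C) (mpolyX0 q C)) mcoeffCM mcoeffX.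
have -> : ((\sum_(i < d) letter_exponent (r i))%MM
    == [multinom (l k : nat) | k < q]) = has_index l r.
  have cnt k : (\sum_(i < d) letter_exponent (r i))%MM k
      = #|[set i | r i == k.+1 :> nat]|.
    rewrite mnm_sumE -sum1dep_card [RHS]big_mkcond /=.
    by apply: eq_bigr => i _; rewrite mnmE; case: (_ == _).
  apply/eqP/forallP => [E k|E]; first by rewrite -cnt E mnmE.
  by apply/mnmP => k; rewrite cnt mnmE; apply/eqP.
by case: has_index; rewrite ?mulr1 ?mulr0.
Qed.

(** The multinomial theorem.  Each partial derivative of [p = 1 + sum_k X_k] is
    [1], so [p ^+ d.+1] has the derivative [d.+1 * p ^+ d], which determines its
    coefficients from those of [p ^+ d]. *)
Lemma mcoeff_linear_exp n d (m : 'X_{1..n}) : (mdeg m <= d)%N ->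
  ((1 + \sum_(k < n) 'X_k : {mpoly int[n]}) ^+ d)@_m
    *+ ((d - mdeg m)`! * \prod_k (m k)`!) = (d`!)%:R.
Proof.
set p : {mpoly _[n]} := 1 + _.
move: {2}(mdeg m) (erefl (mdeg m)) => s; elim: s => [|s IH] in d m *.
  move=> ms _; have /eqP -> : m == 0%MM by rewrite -mdeg_eq0 ms.
  rewrite mdeg0 subn0 big1 => [|k _]; last by rewrite mnm0E.
  rewrite rmorphXn /= /p mcoeffD raddf_sum /= big1 => [|k _].
    by rewrite mcoeff1 eqxx addr0 expr1n muln1.
  by rewrite mcoeffX mnm1_eq0.
move=> ms; case: d => [|d]; first by rewrite ms.
have [i mi] : exists i, (U_(i) <= m)%MM.
  have : mdeg m != 0 by rewrite ms.
  rewrite mdegE sum_nat_eq0 negb_forall => /existsP[i mi]; exists i.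
  by rewrite lep1mP.
rewrite -(submK mi); set m' := (m - _)%MM.
have m's : mdeg m' = s.
  by apply/eqP; rewrite -(eqn_add2r 1) -(mdeg1 i) -mdegD submK // mdeg1 ms addn1.
rewrite mdegD mdeg1 m's addn1 ltnS subSS => sd.
have dp : mderiv i p = 1.
  rewrite /p mderivD mderivC add0r raddf_sum /= (bigD1 i) //= big1 => [|j ji].
    by rewrite mderivX mnm1E eqxx scale1r -{1}[U_(i)%MM]add0m addmK mpolyX0 addr0.
  by rewrite mderivX mnm1E (negPf ji) scale0r.
have dpn e : mderiv i (p ^+ e.+1) = p ^+ e *+ e.+1.
  elim: e => [|e IHe]; first by rewrite expr1 dp expr0.
  by rewrite exprS mderivM dp IHe mul1r mulrnAr -exprS [RHS]mulrS.
have := mcoeff_mderiv i (p ^+ d.+1) m'; rewrite dpn mcoeffMn => E.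
have -> : (\prod_k ((m' + U_(i))%MM k)`! = (m' i).+1 * \prod_k (m' k)`!)%N.
  rewrite (bigD1 i) //= [in RHS](bigD1 i) //= mnmDE mnm1E eqxx addn1 factS.
  rewrite -mulnA; congr (_ * (_ * _))%N; apply: eq_bigr => j ji.
  by rewrite mnmDE mnm1E eq_sym (negPf ji) addn0.
by rewrite mulnCA mulrnA -E -mulrnA mulnC mulrnA -m's IH ?m's // -mulrnA factS mulnC.
Qed.

(** With all weights equal to [1], a Krawtchouk polynomial counts the states of
    index [l], and its generating product is [(1 + sum_k X_k) ^+ d]. *)
Lemma card_has_index q d (l : lindex q.+1 d) : (index_norm l <= d)%N ->
  (#|[set r : state q.+1 d | has_index l r]|
    * ((d - index_norm l)`! * \prod_k (l k)`!))%N = d`!.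
Proof.
move=> ld; pose m := [multinom (l k : nat) | k < q].
have ml : mdeg m = index_norm l.
  by rewrite mdegE; apply: eq_bigr => k _; rewrite mnmE.
have := @mcoeff_linear_exp q d m; rewrite ml => /(_ ld).
pose x0 : state q.+1 d := [ffun=> ord0].
have -> : (1 + \sum_(k < q) 'X_k) ^+ d
    = \prod_(i < d) (1 + \sum_(k < q) (1 ^+ x0 i : int)%:MP * 'X_k) :> {mpoly int[q]}.
  under [RHS]eq_bigr => i _ do
    under eq_bigr => k _ do rewrite expr1n mpolyC1 mul1r.
  by rewrite prodr_const card_ord.
have := krawtchoukE (C := int) (th := fun=> 1) l x0 erefl.
rewrite /krawtchouk prod_grouped => ->.
under eq_bigr do rewrite expr1n.
rewrite big1_eq sumr_const -mulrnA.
have -> : (\prod_k (m k)`! = \prod_k (l k)`!)%N.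
  by apply: eq_bigr => k _; rewrite mnmE.
by rewrite cardsE => /eqP; rewrite eqr_nat => /eqP.
Qed.

End KrawtchoukTheory.
Import KrawtchoukTheory.

From mathcomp Require Import all_classical all_reals all_analysis.
From mathcomp Require Import ring lra.
Import numFieldNormedType.Exports.

Local Open Scope classical_set_scope.
Local Open Scope ring_scope.

(** * Random variables with finitely many values *)

Section FiniteRandomVariables.
Context {d0 : measure_display} {Omega : measurableType d0} {R : realType}.
Variable P : probability Omega R.

Lemma fine_prob_bigcup (I : finType) (D : pred I) (F : I -> set Omega) :
  (forall i, measurable (F i)) -> trivIset setT F ->
  fine (P (\bigcup_(i in [set` D]) F i)) = \sum_(i | D i) fine (P (F i)).
Proof.
move=> mF tF; rewrite measure_fin_bigcup //; last exact: sub_trivIset tF.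
have -> : [set` D] = [set` enum D].
  by apply/seteqP; split=> i /=; rewrite mem_enum.
rewrite -fsbig_seq ?enum_uniq // big_enum /=.
rewrite -sum_fine // => i _; exact: fin_num_measure.
Qed.

Lemma finite_rv_measurable (S : finType) (Y : Omega -> S) (B : set S) :
  finite_rv Y -> measurable (Y @^-1` B).
Proof.
move=> mY; have -> : Y @^-1` B = \bigcup_(s in B) Y @^-1` [set s].
  by apply/seteqP; split=> [w Bw|w [s Bs] /= -> //]; exists (Y w).
exact: fin_bigcup_measurable.
Qed.

Lemma expectation_finite_rv (S : finType) (Y : Omega -> S) (g : S -> R) :
  finite_rv Y ->
  fine ('E_P[fun w => g (Y w)])%E = \sum_s fine (P (Y @^-1` [set s])) * g s.
Proof.
move=> mY; rewrite unlock.
have -> : (fun w => (g (Y w))%:E) =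
    (fun w => \sum_s (g s)%:E * (\1_(Y @^-1` [set s]) w)%:E)%E.
  apply/funext => w; rewrite (bigD1 (Y w)) //= big1 => [|s sY].
    by rewrite indicE mem_set // mule1 adde0.
  by rewrite indicE memNset ?mule0 // => /= E; rewrite E eqxx in sY.
have iY s : P.-integrable setT (fun w => (\1_(Y @^-1` [set s]) w)%:E).
  exact: integrable_indic.
rewrite integral_sum //; last by move=> s; exact: integrableZl.
rewrite -sum_fine => [|s _].
  apply: eq_bigr => s _; rewrite integralZl // integral_indic // setIT mulrC.
  by rewrite fineM //; exact: fin_num_measure.
rewrite integralZl // integral_indic // setIT fin_numM //.
exact: fin_num_measure.
Qed.

Lemma sum_prob_finite_rv (S : finType) (Y : Omega -> S) :
  finite_rv Y -> \sum_s fine (P (Y @^-1` [set s])) = 1.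
Proof.
move=> mY; rewrite -fine_prob_bigcup //.
- rewrite (_ : \bigcup_(_ in _) _ = setT) ?probability_setT //.
  by apply/seteqP; split=> w // _; exists (Y w).
- by apply/trivIsetP => s s' _ _ /eqP ss'; apply/seteqP; split=> w // [/= -> ].
Qed.

End FiniteRandomVariables.

(** * Random dynamics driven by independent noise *)

(** The [t]-step transition probabilities from [x] of the chain that moves from [u]
    to [step u v], where the noise [v] is drawn with probability [p v]. *)
Fixpoint transition (R : realType) (S T : finType) (step : S -> T -> S)
    (p : T -> R) (x : S) (t : nat) (y : S) : R :=
  if t is t'.+1 then
    \sum_(w : S * T | step w.1 w.2 == y) transition step p x t' w.1 * p w.2
  else (x == y)%:R.

Section RandomDynamics.
Context {d0 : measure_display} {Omega : measurableType d0} {R : realType}.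
Variables (P : probability Omega R) (S T : finType) (step : S -> T -> S).
Variables (X : nat -> Omega -> S) (Z : nat -> Omega -> T) (p : T -> R).
Hypotheses (mX0 : finite_rv (X 0%N)) (mZ : forall t, finite_rv (Z t)).
Hypothesis lawZ : forall t v, fine (P (Z t @^-1` [set v])) = p v.
Hypothesis indepZ : mutually_independent P Z.
Hypothesis indepX0 : independent_of_sequence P (X 0%N) Z.
Hypothesis stepX : forall t w, X t.+1 w = step (X t w) (Z t w).

Let tr := transition step p.

Lemma finite_rv_dynamics t : finite_rv (X t).
Proof.
elim: t => // t IH y.
have -> : X t.+1 @^-1` [set y] = \bigcup_(w in [set w | step w.1 w.2 = y])
    (X t @^-1` [set w.1] `&` Z t @^-1` [set w.2]).
  apply/seteqP; split=> [w /= Ew|w [[u v] /= Ey [Eu Ev]]].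
    by exists (X t w, Z t w); rewrite //= -stepX.
  by rewrite stepX Eu Ev.
apply: fin_bigcup_measurable => // w _; apply: measurableI => //; exact: mZ.
Qed.

(** The Markov property.  The future noise [Z_t, ..., Z_(t+n-1)] is kept in the
    event so that the induction on [t] can go on: splitting on the values of [X_t]
    and [Z_t] expresses the claim at [t.+1] by that at [t] with one more noise
    variable, and at [t = 0] the claim is the independence hypothesis. *)
Lemma fine_prob_joint (x : S) t n (A : nat -> {set T}) y :
  fine (P (X 0%N @^-1` [set x] `&` X t @^-1` [set y] `&`
           \bigcap_(j in [set` iota t n]) Z j @^-1` [set` A j]))
  = fine (P (X 0%N @^-1` [set x])) * tr x t y *
    \prod_(j <- iota t n) fine (P (Z j @^-1` [set` A j])).
Proof.
have finP B : measurable B -> P B \is a fin_num by exact: fin_num_measure.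
elim: t => [|t IH] in n A y *.
  rewrite /tr /=; case: eqVneq => [<-|xy]; last first.
    rewrite mulr0 mul0r (_ : _ `&` _ = set0) ?measure0 //.
    by rewrite -subset0 => w [[/= -> E]]; rewrite E eqxx in xy.
  rewrite mulr1 setIid; have := indepX0 [set x]%SET (iota 0 n) A.
  have -> : [set` [set x]%SET] = [set x].
    by apply/seteqP; split=> s /=; rewrite inE => /eqP.
  move=> ->; rewrite indepZ ?iota_uniq //.
  have -> : (\prod_(j <- iota 0 n) P (Z j @^-1` [set` A j]))%E
      = (\prod_(j <- iota 0 n) fine (P (Z j @^-1` [set` A j])))%:E.
    rewrite -prodEFin; apply: eq_bigr => j _; rewrite fineK //.
    by apply: finP; exact: finite_rv_measurable.
  by rewrite fineM // finP.
(* [A'] prescribes the value of [Z_t] in addition to the constraints [A]. *)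
pose A' v j := if j == t then [set v]%SET else A j.
pose F w := X 0%N @^-1` [set x] `&` X t @^-1` [set w.1] `&`
  \bigcap_(j in [set` iota t n.+1]) Z j @^-1` [set` A' w.2 j].
have -> : X 0%N @^-1` [set x] `&` X t.+1 @^-1` [set y] `&`
    \bigcap_(j in [set` iota t.+1 n]) Z j @^-1` [set` A j]
  = \bigcup_(w in [set` [pred w : S * T | step w.1 w.2 == y]]) F w.
  apply/seteqP; split=> [w [[X0 Xy] ZA]|w [[u v] /= Ey [[X0 Xu] ZA]]].
    exists (X t w, Z t w); first by rewrite /= inE /= -stepX; apply/eqP.
    split=> // j /=; rewrite in_cons /A' => /orP[/eqP ->|jt].
      by rewrite eqxx /= inE.
    case: eqP => [->|_]; first by rewrite /= inE.
    exact: ZA.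
  split; first split=> //=.
    have := ZA t; rewrite /= in_cons eqxx /A' eqxx /= => /(_ isT).
    by rewrite inE stepX Xu => /eqP ->; apply/eqP.
  move=> j jt; have := ZA j; rewrite /= in_cons jt orbT /A' => /(_ isT).
  move: jt; rewrite /= mem_iota; case: eqP => // ->; by rewrite ltnn.
rewrite fine_prob_bigcup.
- rewrite /tr /= mulr_sumr mulr_suml; apply: eq_bigr => -[u v] _ /=.
  rewrite IH big_cons /A' eqxx -mulrA -mulrA; congr (_ * _).
  rewrite -!mulrA; congr (_ * _); congr (_ * _).
    rewrite -(lawZ t); congr (fine (P _)).
    by apply/seteqP; split=> w /=; rewrite inE => /eqP.
  apply: eq_big_seq => j; rewrite mem_iota; case: eqP => // ->.
  by rewrite ltnn.
- move=> w; apply: measurableI; first by apply: measurableI; exact: finite_rv_dynamics.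
  by apply: fin_bigcap_measurable => // j _; exact: finite_rv_measurable.
- apply/trivIsetP => -[u v] [u' v'] _ _ /= /eqP neq; apply: contrapT.
  move=> /eqP/set0P[w [[[_ /= Eu] ZA] [[_ /= Eu'] ZA']]]; apply: neq.
  have tt : t \in iota t n.+1 by rewrite in_cons eqxx.
  have := ZA t tt; have := ZA' t tt.
  by rewrite /A' eqxx /= !inE -Eu -Eu' => /eqP -> /eqP ->.
Qed.

Lemma cond_prob_dynamics (x : S) t y : (0 < P (X 0%N @^-1` [set x]))%E ->
  cond_prob P (X t @^-1` [set y]) (X 0%N @^-1` [set x]) = tr x t y.
Proof.
move=> Px; have := fine_prob_joint x t 0 (fun=> [set: T]%SET) y.
rewrite bigcap_seq !big_nil setIT mulr1 /cond_prob setIC => ->.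
rewrite mulrAC divff ?mul1r // gt_eqF // fine_gt0 // Px /=.
by rewrite ltey_eq fin_num_measure.
Qed.

End RandomDynamics.

(** * The renewal equation of the Green function *)

Lemma sum_image_partition (C : nmodType) (I J : finType) (f : I -> J)
    (F : I -> J -> C) :
  \sum_y \sum_(w | f w == y) F w y = \sum_w F w (f w).
Proof.
rewrite [RHS](partition_big f xpredT) //=; apply: eq_bigr => y _.
by apply: eq_bigr => w /eqP <-.
Qed.

Section Renewal.
Variables (R : realType) (S T : finType) (step : S -> T -> S) (p : T -> R).
Variable alpha : R.
Hypotheses (p_ge0 : forall v, 0 <= p v) (p_sum : \sum_v p v = 1).
Hypotheses (alpha_gt0 : 0 < alpha) (alpha_lt1 : alpha < 1).

Let tr := transition step p.

Lemma transition_ge0 x t y : 0 <= tr x t y.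
Proof.
elim: t y => [|t IH] y /=; first exact: ler0n.
by apply: sumr_ge0 => w _; rewrite mulr_ge0 ?IH.
Qed.

Lemma transition_sum x t : \sum_y tr x t y = 1.
Proof.
rewrite /tr; elim: t => [|t IH] /=.
  rewrite (bigD1 x) //= eqxx big1 ?addr0 // => y /negPf.
  by rewrite eq_sym => ->.
rewrite (sum_image_partition (fun w : S * T => step w.1 w.2)
  (fun w _ => transition step p x t w.1 * p w.2)).
rewrite -(pair_bigA _ (fun u v => transition step p x t u * p v)) /=.
by under eq_bigr do rewrite -mulr_sumr p_sum mulr1.
Qed.

Lemma transition_le1 x t y : tr x t y <= 1.
Proof.
rewrite -(transition_sum x t) (bigD1 y) //= lerDl.
by apply: sumr_ge0 => z _; exact: transition_ge0.
Qed.

Let green_series x y : R ^nat := series (fun t => alpha ^+ t * tr x t y).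

Lemma is_cvg_green_series x y : cvgn (green_series x y).
Proof.
apply: (@series_le_cvg _ _ (geometric 1 alpha)).
- by move=> t; rewrite mulr_ge0 ?transition_ge0 // exprn_ge0 // ltW.
- by move=> t; rewrite /geometric /= mul1r exprn_ge0 // ltW.
- move=> t; rewrite /geometric /= mul1r ler_piMr ?transition_le1 //.
  by rewrite exprn_ge0 // ltW.
- by apply: is_cvg_geometric_series; rewrite ger0_norm // ltW.
Qed.

(** The partial sums satisfy the equation up to a shift of the last index, by the
    recursion for the transition probabilities; pass to the limit. *)
Lemma green_renewal x y :
  limn (green_series x y) = (x == y)%:R +
    alpha * \sum_(w : S * T | step w.1 w.2 == y)
              limn (green_series x w.1) * p w.2.
Proof.
have cvgG z : green_series x z n @[n --> \oo] --> limn (green_series x z).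
  exact: is_cvg_green_series.
have /cvg_lim <- // : green_series x y n.+1 @[n --> \oo] --> limn (green_series x y).
  by rewrite (cvg_shiftS (green_series x y)); exact: cvgG.
have -> : (fun n => green_series x y n.+1) = fun n => (x == y)%:R +
    alpha * \sum_(w : S * T | step w.1 w.2 == y) green_series x w.1 n * p w.2.
  apply/funext => n; rewrite /green_series !seriesEnat /= big_nat_recl //=.
  rewrite expr0 mul1r; congr (_ + _).
  under eq_bigr do rewrite exprS -mulrA mulr_sumr.
  rewrite -mulr_sumr exchange_big /=; congr (_ * _); apply: eq_bigr => w _.
  by rewrite mulr_suml; apply: eq_bigr => t _; rewrite mulrA.
apply: cvg_lim => //; apply: cvgD; first exact: cvg_cst.
apply: cvgM; first exact: cvg_cst.
apply: cvg_big => [|w _]; first exact: add_continuous.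
by apply: cvgM; [exact: cvgG | exact: cvg_cst].
Qed.

End Renewal.

(** * Characters of the group of states *)

Section RootsOfUnity.
Variables (R : realType) (q : nat).
Hypothesis q_gt0 : (0 < q)%N.

Lemma theta0 : theta R q 0 = 1.
Proof. by rewrite /theta mulr0 mul0r cos0 sin0. Qed.

Lemma thetaE k : theta R q k = theta R q 1 ^+ k.
Proof.
elim: k => [|k IH]; first by rewrite theta0 expr0.
rewrite exprS -IH /theta.
have -> : 2 * pi * k.+1%:R / q%:R = 2 * pi * 1%:R / q%:R + 2 * pi * k%:R / q%:R :> R.
  by rewrite -mulrDl -mulrDr -natrD add1n.
by rewrite cosD sinD; apply/eqP; rewrite eq_complex /= eqxx /= addrC.
Qed.

Lemma norm_theta k : `|theta R q k| = 1.
Proof. by rewrite normc_def /theta /= cos2Dsin2 sqrtr1. Qed.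

Lemma conj_theta k : (theta R q k)^* = (theta R q k)^-1.
Proof. by rewrite invC_norm norm_theta expr1n invr1 mul1r. Qed.

(** If [theta R q k = 1] with [0 < k < q], then [cos (2 pi k / q) = 1], which makes
    [sin (pi k / q)] vanish although [pi k / q] lies strictly between [0] and [pi]. *)
Lemma theta_prim : q.-primitive_root (theta R q 1).
Proof.
rewrite /primitive_root_of_unity q_gt0; apply/forallP => i /=.
rewrite unity_rootE -thetaE /theta; apply/eqP.
set k := i.+1; have q0 : q%:R != 0 :> R by rewrite pnatr_eq0 -lt0n.
have -> : 2 * pi * k%:R / q%:R = (pi * k%:R / q%:R) *+ 2 :> R.
  by rewrite -[RHS]mulr_natl !mulrA.
case: (eqVneq k q) => [->|kq].
  by rewrite mulfK // cos2pi sin2pi; apply/eqP.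
apply/negbTE; rewrite eq_complex /= negb_and; apply/orP; left.
have /sin_gt0_pi sin_gt0 : 0 < (pi * k%:R / q%:R : R) < pi.
  rewrite divr_gt0 ?mulr_gt0 ?pi_gt0 ?ltr0n //=.
  rewrite ltr_pdivrMr ?ltr0n // ltr_pM2l ?pi_gt0 // ltr_nat.
  by rewrite ltn_neqAle kq ltn_ord.
rewrite cos_mulr2n cos2sin2; apply/eqP => E.
have : sin (pi * k%:R / q%:R) ^+ 2 = 0 :> R by lra.
by move/eqP; rewrite sqrf_eq0 gt_eqF.
Qed.

End RootsOfUnity.

Section Characters.
Variables (R : realType) (q d : nat).
Hypothesis q_gt0 : (0 < q)%N.
Implicit Types x y r u v : state q d.

Definition character x r : R[i] := theta R q 1 ^+ dotn x r.

Lemma characterE x r : character x r = \prod_i theta R q (x i) ^+ r i.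
Proof.
by rewrite /character /dotn expr_sum; apply: eq_bigr => i _; rewrite exprM -thetaE.
Qed.

Lemma character_sym x r : character x r = character r x.
Proof. by congr (_ ^+ _); apply: eq_bigr => i _; rewrite mulnC. Qed.

Lemma norm_character x r : `|character x r| = 1.
Proof. by rewrite normrX norm_theta expr1n. Qed.

Lemma conj_character x r : (character x r)^* = (character x r)^-1.
Proof. by rewrite invC_norm norm_character expr1n invr1 mul1r. Qed.

Lemma theta_dot_diff x y r :
  theta R q 1 ^ dot_diff x y r = character x r * (character y r)^*.
Proof.
have th0 : theta R q 1 \is a GRing.unit.
  by rewrite unitfE -normr_eq0 norm_theta oner_eq0.
have -> : dot_diff x y r = (dotn x r)%:Z - (dotn y r)%:Z.
  rewrite /dot_diff /dotn !(big_morph Posz PoszD (erefl : Posz 0 = 0)) -sumrB.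
  by apply: eq_bigr => i _; rewrite mulrBl.
by rewrite expfzDr -?unitfE // -invr_expz conj_character.
Qed.

(** The sum factors over the coordinates into geometric sums of the [q]-th roots of
    unity [z i]; one of them is a sum over a nontrivial root unless [x = y]. *)
Lemma character_orthogonality x y :
  \sum_r character x r * (character y r)^* = q%:R ^+ d * (x == y)%:R.
Proof.
pose z i := theta R q (x i) / theta R q (y i).
have -> : \sum_r character x r * (character y r)^* = \prod_i \sum_(k < q) z i ^+ k.
  rewrite bigA_distr_bigA; apply: eq_bigr => r _.
  rewrite !characterE rmorph_prod -big_split; apply: eq_bigr => i _ /=.
  by rewrite rmorphXn /= conj_theta -exprMn.
have th_neq0 k : theta R q k != 0 by rewrite -normr_eq0 norm_theta oner_eq0.
have th_q k : theta R q k ^+ q = 1.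
  by rewrite thetaE exprAC (prim_expr_order (theta_prim R q_gt0)) expr1n.
have [xy|xy] := eqVneq x y.
  rewrite mulr1 -[d in RHS]card_ord -prodr_const; apply: eq_bigr => i _.
  under eq_bigr do rewrite /z xy divff // expr1n.
  by rewrite sumr_const card_ord.
have [i xyi] : exists i, x i != y i.
  by apply/existsP; rewrite -negb_forall; apply: contra xy => /eqfunP/ffunP ->.
have zi : z i != 1.
  rewrite -subr_eq0 -(mulIr_eq0 _ (mulIf (th_neq0 (y i)))) mulrBl mul1r divfK //.
  rewrite subr_eq0 !(thetaE _ _ (nat_of_ord _)) (eq_prim_root_expr (theta_prim R q_gt0)).
  by rewrite !modn_small.
rewrite mulr0 (bigD1 i) //=; apply/eqP; rewrite mulf_eq0; apply/orP; left.
rewrite -(mulrI_eq0 _ (mulfI (x := z i - 1) _)) ?subr_eq0 // -subrX1.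
by rewrite expr_div_n !th_q divr1 subrr.
Qed.

Lemma fourier_inversion (f : state q d -> R[i]) y :
  f y = (q%:R ^+ d)^-1 *
    \sum_r (\sum_u f u * character u r) * (character y r)^*.
Proof.
under eq_bigr do rewrite mulr_suml.
rewrite exchange_big /=; under eq_bigr => u _ do
  (under eq_bigr do rewrite -mulrA; rewrite -mulr_sumr character_orthogonality).
rewrite (bigD1 y) //= eqxx big1 => [|u /negPf ->]; last by rewrite !mulr0.
rewrite addr0 mulr1 mulrCA mulVf ?mulr1 //.
by rewrite expf_neq0 // pnatr_eq0 -lt0n.
Qed.

End Characters.

(** * The spectral formula for the Green function *)

Lemma conv_norm_le1 (R : rcfType) (T : finType) (p : T -> R) (z : T -> R[i]) :
  (forall v, 0 <= p v) -> \sum_v p v = 1 -> (forall v, `|z v| = 1) ->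
  `|\sum_v ((p v)%:C)%C * z v| <= 1.
Proof.
move=> p0 p1 z1; apply: le_trans (ler_norm_sum _ _ _) _.
under eq_bigr do rewrite normrM z1 mulr1 ger0_norm ?lecR //.
by rewrite -rmorph_sum p1.
Qed.

Section Walk.
Variables (R : realType) (dV d0 : measure_display).
Variables (OmegaV : measurableType dV) (Omega : measurableType d0).
Variables (PV : probability OmegaV R) (P : probability Omega R) (q d : nat).
Variables (alpha : R) (V : OmegaV -> state q d).
Variables (X Z : nat -> Omega -> state q d).
Hypotheses (q_gt0 : (0 < q)%N) (alpha_gt0 : 0 < alpha) (alpha_lt1 : alpha < 1).
Hypotheses (mV : finite_rv V) (walk : random_walk PV P V X Z).

Definition add_mod (u v : state q d) : state q d :=
  [ffun k => Ordinal (ltn_pmod (u k + v k) (leq_ltn_trans (leq0n _) (ltn_ord (u k))))].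

Lemma character_add_mod u v r :
  character R (add_mod u v) r = character R u r * character R v r.
Proof.
rewrite !characterE -big_split; apply: eq_bigr => i _; rewrite ffunE /=.
rewrite -exprMn; congr (_ ^+ _); rewrite thetaE.
by rewrite (prim_expr_mod (theta_prim R q_gt0)) exprD -!thetaE.
Qed.

Let p v := fine (PV (V @^-1` [set v])).

Lemma rhoE r : rho PV V r = \sum_v ((p v)%:C)%C * character R v r.
Proof.
rewrite /rho /complex_expectation.
rewrite (expectation_finite_rv PV (fun v => complex.Re (character R v r)) mV).
rewrite (expectation_finite_rv PV (fun v => complex.Im (character R v r)) mV).
apply: (big_rec3 (fun (a b : R) c => (a +i* b)%C = c)) => // v a b c _ <-.
apply/eqP; rewrite eq_complex /=; case: (character R v r) => e f /=.
by rewrite !mul0r subr0 addr0 !eqxx.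
Qed.

(** [rho] is a mean of numbers of modulus [1]. *)
Lemma norm_rho r : `|rho PV V r| <= 1.
Proof.
rewrite rhoE; apply: conv_norm_le1; last by move=> v; exact: norm_character.
  by move=> v; exact: fine_ge0.
exact: sum_prob_finite_rv.
Qed.

Lemma killed_neq0 r : 1 - (alpha%:C)%C * rho PV V r != 0.
Proof.
rewrite subr_eq0; apply/eqP => E.
have : `|(alpha%:C)%C * rho PV V r| < 1.
  rewrite normrM; apply: le_lt_trans (_ : `|(alpha%:C)%C| < 1).
    by rewrite ler_piMr // norm_rho.
  by rewrite ger0_norm ?lecR ?ltcR // ltW.
by rewrite -E normr1 ltxx.
Qed.

Lemma killed_invE r :
  (1 + ((alpha / (1 - alpha))%:C)%C * (1 - rho PV V r))^-1
    = ((1 - alpha)%:C)%C / (1 - (alpha%:C)%C * rho PV V r).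
Proof.
rewrite rmorphM fmorphV rmorphB rmorph1 -[RHS]invf_div; congr _^-1.
have : 1 - (alpha%:C)%C != 0 :> R[i].
  by rewrite -(rmorph1 (real_complex R)) -rmorphB fmorph_eq0 subr_eq0 gt_eqF.
by move=> ?; field.
Qed.

Lemma green_renewal_walk x y : (0 < P (X 0%N @^-1` [set x]))%E ->
  green P X alpha x y = (x == y)%:R +
    alpha * \sum_(w : state q d * state q d | add_mod w.1 w.2 == y)
              green P X alpha x w.1 * p w.2.
Proof.
case: walk => mX0 mZ lawZ indepZ indepX0 stepX Px.
have E z : green P X alpha x z =
    limn (series (fun t => alpha ^+ t * transition add_mod p x t z)).
  rewrite /green; congr (limn (series _)); apply/funext => t; congr (_ * _).
  apply: (cond_prob_dynamics mX0 mZ) => //.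
  - by move=> s v; rewrite lawZ.
  - by move=> s w; apply/ffunP => k; apply: val_inj; rewrite ffunE /= stepX.
rewrite E green_renewal //; last 2 first.
- by move=> v; apply: fine_ge0.
- exact: sum_prob_finite_rv.
by under [in RHS]eq_bigr do rewrite E.
Qed.

(** The pairing of the renewal equation with a character: since
    [character (u + v) r = character u r * character v r], the sum over the last
    transition splits into the transform of [green] times [rho]. *)
Lemma green_fourier x r : (0 < P (X 0%N @^-1` [set x]))%E ->
  (1 - (alpha%:C)%C * rho PV V r) *
    \sum_y ((green P X alpha x y)%:C)%C * character R y r = character R x r.
Proof.
move=> Px; rewrite mulrBl mul1r; apply/eqP; rewrite subr_eq; apply/eqP.
under [LHS]eq_bigr do rewrite green_renewal_walk // rmorphD mulrDl rmorph_nat.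
rewrite big_split /= (bigD1 x) //= eqxx mul1r big1 ?addr0; last first.
  by move=> y /negPf; rewrite eq_sym => ->; rewrite mul0r.
congr (_ + _); under [LHS]eq_bigr do rewrite rmorphM -mulrA.
rewrite -mulr_sumr -mulrA; congr (_ * _); rewrite rhoE.
under [LHS]eq_bigr => y _ do rewrite rmorph_sum mulr_suml.
rewrite (sum_image_partition (fun w : state q d * state q d => add_mod w.1 w.2)
  (fun w y => ((green P X alpha x w.1 * p w.2)%:C)%C * character R y r)).
rewrite mulr_suml -(pair_bigA _ (fun u v => ((green P X alpha x u * p v)%:C)%C *
     character R (add_mod u v) r)) exchange_big.
apply: eq_bigr => v _; rewrite mulr_sumr; apply: eq_bigr => u _.
by rewrite rmorphM character_add_mod /= mulrACA [LHS]mulrC; ring.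
Qed.

Lemma green_formula x y : (0 < P (X 0%N @^-1` [set x]))%E ->
  (((1 - alpha) * green P X alpha x y)%:C)%C
    = (q%:R ^+ d)^-1 *
      (\sum_(r : state q d)
         (1 + ((alpha / (1 - alpha))%:C)%C * (1 - rho PV V r))^-1 *
         (character R x r * (character R y r)^*)).
Proof.
move=> Px; rewrite rmorphM /= (fourier_inversion q_gt0 (fun y => ((green P X alpha x y)%:C)%C)).
rewrite mulrCA; congr (_ * _); rewrite mulr_sumr; apply: eq_bigr => r _.
rewrite killed_invE -(green_fourier r Px) /=.
have := killed_neq0 r; move: (1 - _) => a a0.
by rewrite !mulrA divfK.
Qed.

End Walk.

(** * States up to rearrangement of their entries *)

Section Grouping.
Variables (q d : nat).
Implicit Types (x y r : state q.+1 d) (l : lindex q.+1 d).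

(** The counts are at most [d], so [inord] does not truncate. *)
Definition index_of r : lindex q.+1 d :=
  [ffun k : 'I_q => inord #|[set i | (r i == k.+1 :> nat)]%SET|].

Lemma has_indexE l r : has_index l r = (index_of r == l).
Proof.
have lt k : (#|[set i | (r i == k.+1 :> nat)]%SET| < d.+1)%N.
  by rewrite ltnS -[d in leqRHS]card_ord max_card.
apply/forallP/eqP => [E|<- k]; last by rewrite ffunE inordK.
by apply/ffunP => k; apply: val_inj; rewrite ffunE /= inordK //; apply/eqP/E.
Qed.

Lemma grouped_lift l r k : has_index l r -> grouped r (lift ord0 k) = l k.
Proof.
move=> /forallP/(_ k)/eqP <-; rewrite ffunE; apply: eq_card => i.
by rewrite !inE -(inj_eq val_inj).
Qed.

Lemma sum_grouped r : (\sum_j grouped r j = d)%N.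
Proof.
rewrite -[RHS]card_ord -sum1_card (partition_big r xpredT) //=.
by apply: eq_bigr => j _; rewrite ffunE -sum1dep_card.
Qed.

Lemma has_index_norm l r : has_index l r -> (index_norm l + grouped r ord0 = d)%N.
Proof.
move=> lr; rewrite -[RHS](sum_grouped r) big_ord_recl addnC; congr (_ + _)%N.
by apply: eq_bigr => k _; rewrite (grouped_lift _ lr).
Qed.

(** An index omits the number of zero entries, which is recovered because all counts
    add up to [d]. *)
Lemma grouped_eq x y : (grouped x == grouped y) = has_index (index_of y) x.
Proof.
have Hy : has_index (index_of y) y by rewrite has_indexE.
apply/eqP/idP => [E|Hx].
  have Hx : has_index (index_of x) x by rewrite has_indexE.
  rewrite has_indexE; apply/eqP/ffunP => k; apply: val_inj => /=.
  by rewrite -(grouped_lift _ Hx) -(grouped_lift _ Hy) E.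
apply/ffunP => j; case: (unliftP ord0 j) => [k ->|->].
  by rewrite (grouped_lift _ Hx) (grouped_lift _ Hy).
by apply/eqP; rewrite -(eqn_add2l (index_norm (index_of y))) !has_index_norm.
Qed.

Lemma grouped_permute x y : grouped x = grouped y -> exists s : 'S_d, x = permute s y.
Proof.
move=> E.
have : perm_eq [tuple x i | i < d] [tuple y i | i < d].
  have cnt (z : state q.+1 d) j : count_mem j [tuple z i | i < d] = grouped z j.
    rewrite ffunE cardE /enum_mem size_filter /= count_map -enumT.
    by apply: eq_count => i /=; rewrite !inE.
  by apply/allP => j _ /=; rewrite !cnt E.
move=> /tuple_permP[s Es]; exists s; apply/ffunP => i; rewrite ffunE.
by have := congr1 (fun t => tnth t i) (val_inj Es); rewrite !tnth_mktuple.
Qed.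

End Grouping.

Section CharacterSums.
Variables (R : realType) (q d : nat).
Implicit Types (x y r : state q.+1 d) (l : lindex q.+1 d).

Lemma krawtchouk_character l x :
  krawtchouk (theta R q.+1) l (grouped x)
    = \sum_(r | has_index l r) character R x r.
Proof.
rewrite krawtchoukE ?theta0 //; apply: eq_bigr => r _.
by rewrite character_sym characterE.
Qed.

Lemma hinv_card l : (index_norm l <= d)%N ->
  hinv R[i] l = #|[set r : state q.+1 d | has_index l r]%SET|%:R.
Proof.
move=> ld; rewrite /hinv -(card_has_index ld) natrM mulfK //.
rewrite pnatr_eq0 -lt0n muln_gt0 fact_gt0 prodn_gt0 // => k.
exact: fact_gt0.
Qed.

(** Double counting of the pairs [(y', r')] with [y'] a rearrangement of [y] and
    [r'] of index [l].  Summing over [r'] first gives [Q_l(grouped y)] for each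
    [y'].  Summing over [y'] first gives, by symmetry of the pairing, a Krawtchouk
    polynomial indexed by [y], evaluated at [grouped r'], hence the same value for
    all [r']. *)
Lemma sum_character_grouped l r y : has_index l r ->
  \sum_(y' : state q.+1 d | grouped y' == grouped y) character R y' r
    = #|[set y' : state q.+1 d | grouped y' == grouped y]%SET|%:R *
      (h R[i] l * krawtchouk (theta R q.+1) l (grouped y)).
Proof.
move=> lr; set O := [set y' | _]%SET; set B := [set r' : state q.+1 d | has_index l r']%SET.
have innerE r' : \sum_(y' : state q.+1 d | grouped y' == grouped y) character R y' r'
    = krawtchouk (theta R q.+1) (index_of y) (grouped r').
  rewrite krawtchouk_character; apply: eq_big => y'; first exact: grouped_eq.
  by rewrite character_sym.
have B0 : #|B|%:R != 0 :> R[i].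
  by rewrite pnatr_eq0 -lt0n; apply/card_gt0P; exists r; rewrite inE.
have ld : (index_norm l <= d)%N by exact: leq_trans (leq_addr _ _) (eq_leq (has_index_norm lr)).
apply: (mulfI B0); rewrite mulrCA /h hinv_card // -/B (mulVKf B0).
transitivity (\sum_(r' in B)
    \sum_(y' : state q.+1 d | grouped y' == grouped y) character R y' r').
  rewrite [RHS](eq_bigr (fun=> krawtchouk (theta R q.+1) (index_of y) (grouped r))).
    by rewrite sumr_const innerE mulr_natl.
  move=> r'; rewrite inE innerE => lr'.
  suff /eqP -> : grouped r' == grouped r by [].
  by rewrite grouped_eq; move: lr; rewrite [in X in X -> _]has_indexE => /eqP ->.
rewrite exchange_big /= -sumr_const mulr_suml; apply: eq_big => [y'|y' /eqP Oy].
  by rewrite inE.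
rewrite -Oy krawtchouk_character mul1r; apply: eq_bigl => r'.
by rewrite inE.
Qed.

End CharacterSums.

Section Exchangeable.
Variables (R : realType) (dV : measure_display) (OmegaV : measurableType dV).
Variables (PV : probability OmegaV R) (q d : nat) (V : OmegaV -> state q.+1 d).
Hypotheses (mV : finite_rv V) (exV : exchangeable_entries PV V).

Lemma permute_inj (s : 'S_d) : injective (permute s : state q.+1 d -> _).
Proof.
move=> u v /ffunP E; apply/ffunP => k.
by have := E (s^-1 k)%g; rewrite !ffunE permKV.
Qed.

Lemma character_permute s (v r : state q.+1 d) :
  character R (permute s v) (permute s r) = character R v r.
Proof.
congr (_ ^+ _); rewrite /dotn [RHS](reindex_inj (@perm_inj _ s)) /=.
by apply: eq_bigr => i _; rewrite !ffunE.
Qed.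

(** Permuting the entries of both arguments preserves the character, and permuting
    those of [V] preserves its law. *)
Lemma rho_permute s r : rho PV V (permute s r) = rho PV V r.
Proof.
rewrite !rhoE // (reindex_inj (@permute_inj s)) /=; apply: eq_bigr => v _.
rewrite character_permute -[in LHS](exV s) (_ : _ @^-1` _ = V @^-1` [set v]) //.
by apply/seteqP; split=> w /= => [/permute_inj|->].
Qed.

Lemma kappaE l r : has_index l r -> kappa PV V l = rho PV V r.
Proof.
move=> lr; rewrite /kappa; case: pickP => [r' lr'|/(_ r)]; last by rewrite lr.
have [|s ->] := @grouped_permute _ _ r' r; last exact: rho_permute.
apply/eqP; rewrite grouped_eq has_indexE.
by move: lr lr'; rewrite !has_indexE => /eqP -> /eqP ->.
Qed.

End Exchangeable.

(** * The spectral formula in grouped values *)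

Section IndexSums.
Variables (R : realType) (q d : nat).
Implicit Types (x y r : state q.+1 d) (l : lindex q.+1 d).

Lemma sum_by_index (C : nmodType) (F : lindex q.+1 d -> state q.+1 d -> C) :
  \sum_r F (index_of r) r
    = \sum_(l | (index_norm l <= d)%N) \sum_(r | has_index l r) F l r.
Proof.
rewrite (partition_big (@index_of q d) (fun l => (index_norm l <= d)%N)) /=.
  apply: eq_bigr => l _; apply: eq_big => r; first by rewrite has_indexE.
  by move=> /eqP ->.
move=> r _; have Hr : has_index (index_of r) r by rewrite has_indexE.
exact: leq_trans (leq_addr _ _) (eq_leq (has_index_norm Hr)).
Qed.

Lemma sum_index_split (C : nmodType) (F : lindex q.+1 d -> C) :
  \sum_(l : lindex q.+1 d | (index_norm l <= d)%N) F l
    = F [ffun=> ord0] + \sum_(l : lindex q.+1 d | (0 < index_norm l <= d)%N) F l.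
Proof.
rewrite (bigD1 [ffun=> ord0]) /=; last by rewrite /index_norm big1 // => k _; rewrite ffunE.
congr (_ + _); apply: eq_bigl => l; rewrite andbC; congr (_ && _).
rewrite lt0n /index_norm sum_nat_eq0; congr (~~ _); apply/eqP/forallP => [->|E] /=.
  by move=> k; rewrite ffunE.
by apply/ffunP => k; apply: val_inj; rewrite ffunE; apply/eqP/E.
Qed.

Lemma has_index0 r : has_index [ffun=> ord0] r = (r == [ffun=> ord0]).
Proof.
apply/forallP/eqP => [E|-> k].
  apply/ffunP => i; rewrite ffunE; apply: val_inj => /=.
  case E0 : (r i : nat) => [//|k]; have kq : (k < q)%N by rewrite -ltnS -E0.
  have := E (Ordinal kq); rewrite ffunE cards_eq0 => /eqP/setP/(_ i).
  by rewrite !inE E0 eqxx.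
rewrite ffunE cards_eq0; apply/eqP/setP => i; by rewrite !inE ffunE.
Qed.

Lemma character0 x : character R x [ffun=> ord0] = 1.
Proof. by rewrite characterE big1 // => i _; rewrite ffunE expr0. Qed.

Lemma krawtchouk0 x : krawtchouk (theta R q.+1) ([ffun=> ord0] : lindex q.+1 d) (grouped x) = 1.
Proof.
rewrite krawtchouk_character (eq_bigl (pred1 [ffun=> ord0])).
  by rewrite big_pred1_eq character0.
by move=> r; rewrite has_index0.
Qed.

Lemma h0 : h R[i] ([ffun=> ord0] : lindex q.+1 d) = 1.
Proof.
have n0 : index_norm ([ffun=> ord0] : lindex q.+1 d) = 0%N.
  by rewrite /index_norm big1 // => k _; rewrite ffunE.
rewrite /h hinv_card ?n0 // (_ : [set r | _]%SET = [set [ffun=> ord0]]%SET).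
  by rewrite cards1 invr1.
by apply/setP => r; rewrite !inE has_index0.
Qed.

Lemma conj_h l : (h R[i] l)^* = h R[i] l.
Proof. by rewrite /h /hinv fmorphV /= fmorph_div /= !rmorph_nat. Qed.

End IndexSums.

Section GroupedGreen.
Variables (R : realType) (dV d0 : measure_display).
Variables (OmegaV : measurableType dV) (Omega : measurableType d0).
Variables (PV : probability OmegaV R) (P : probability Omega R) (q d : nat).
Variables (alpha : R) (V : OmegaV -> state q.+1 d).
Variables (X Z : nat -> Omega -> state q.+1 d).
Hypotheses (alpha_gt0 : 0 < alpha) (alpha_lt1 : alpha < 1).
Hypotheses (mV : finite_rv V) (walk : random_walk PV P V X Z).
Hypothesis exV : exchangeable_entries PV V.

(** The general formula is summed over the rearrangements of [y], the inner character sums are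
    evaluated, and the sum over [r] is grouped by index.  The index [0] belongs to
    the state [0] alone and accounts for the isolated term [1]. *)
Lemma grouped_green_formula x y : (0 < P (X 0%N @^-1` [set x]))%E ->
  (((1 - alpha) * grouped_green P X alpha x y)%:C)%C
     = (q.+1%:R ^+ d)^-1 *
       (1 + \sum_(l : lindex q.+1 d | (0 < index_norm l <= d)%N)
              h R[i] l / (1 + ((alpha / (1 - alpha))%:C)%C * (1 - kappa PV V l)) *
              krawtchouk (theta R q.+1) l (grouped x) *
              (krawtchouk (theta R q.+1) l (grouped y))^*).
Proof.
move=> Px; set O := #|[set y' : state q.+1 d | grouped y' == grouped y]%SET|.
have O0 : O%:R != 0 :> R[i].
  by rewrite pnatr_eq0 -lt0n; apply/card_gt0P; exists y; rewrite inE.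
pose c (rh : R[i]) := 1 + ((alpha / (1 - alpha))%:C)%C * (1 - rh).
pose term l := h R[i] l / c (kappa PV V l) * krawtchouk (theta R q.+1) l (grouped x) *
              (krawtchouk (theta R q.+1) l (grouped y))^*.
have term0 : term [ffun=> ord0] = 1.
  rewrite /term h0 !krawtchouk0 (kappaE mV exV (r := [ffun=> ord0])) ?has_index0 //.
  have -> : rho PV V [ffun=> ord0] = 1.
    rewrite rhoE //; under eq_bigr do rewrite character0 mulr1.
    by rewrite -rmorph_sum sum_prob_finite_rv.
  by rewrite /c subrr mulr0 addr0 divr1 mulr1 mul1r rmorph1.
rewrite -[X in _ * (X + _)]term0 -sum_index_split /grouped_green -/O.
rewrite mulrA rmorphM fmorphV rmorph_nat mulr_sumr rmorph_sum /=.
under eq_bigr do rewrite (green_formula (ltn0Sn q) alpha_gt0 alpha_lt1 mV walk _ Px).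
rewrite -mulr_sumr -mulrA; congr (_ * _); rewrite exchange_big mulr_suml /=.
transitivity (\sum_r h R[i] (index_of r) / c (kappa PV V (index_of r)) * character R x r *
              (krawtchouk (theta R q.+1) (index_of r) (grouped y))^*).
  apply: eq_bigr => r _; have Hr : has_index (index_of r) r by rewrite has_indexE.
  rewrite -!mulr_sumr -rmorph_sum /= (sum_character_grouped R y Hr) -/O.
  rewrite (kappaE mV exV Hr) -/(c _) !rmorphM /= conj_h rmorph_nat.
  by rewrite -[RHS](mulfK O0); congr (_ / _); ring.
rewrite (sum_by_index (fun l r => h R[i] l / c (kappa PV V l) * character R x r *
              (krawtchouk (theta R q.+1) l (grouped y))^*)).
by apply: eq_bigr => l _; rewrite -mulr_suml -mulr_sumr -krawtchouk_character.
Qed.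

End GroupedGreen.

Theorem proposition5 (R : realType) (dV d0 : measure_display)
    (OmegaV : measurableType dV) (Omega : measurableType d0)
    (PV : probability OmegaV R) (P : probability Omega R)
    (q d : nat) (alpha : R)
    (V : OmegaV -> state q d) (X Z : nat -> Omega -> state q d) :
  (2 <= q)%N -> (1 <= d)%N -> 0 < alpha -> alpha < 1 ->
  finite_rv V -> random_walk PV P V X Z ->
  forall x y : state q d, (0 < P (X 0%N @^-1` [set x]))%E ->
  (((1 - alpha) * green P X alpha x y)%:C)%C
    = (q%:R ^+ d)^-1 *
      (\sum_(r : state q d)
         (1 + ((alpha / (1 - alpha))%:C)%C * (1 - rho PV V r))^-1 *
         theta R q 1 ^ dot_diff x y r)
  /\
  (exchangeable_entries PV V ->
   (((1 - alpha) * grouped_green P X alpha x y)%:C)%C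
     = (q%:R ^+ d)^-1 *
       (1 + \sum_(l : lindex q d | (0 < index_norm l <= d)%N)
              h R[i] l / (1 + ((alpha / (1 - alpha))%:C)%C * (1 - kappa PV V l)) *
              krawtchouk (theta R q) l (grouped x) *
              (krawtchouk (theta R q) l (grouped y))^*)).
Proof.
move=> q_ge2 _ alpha_gt0 alpha_lt1 mV walk x y Px; split.
  rewrite (green_formula (ltnW q_ge2) alpha_gt0 alpha_lt1 mV walk y Px).
  by under [in RHS]eq_bigr do rewrite theta_dot_diff.
case: q q_ge2 V X Z mV walk x y Px => // q' _ V' X' Z' mV walk x y Px exV.
exact: (grouped_green_formula alpha_gt0 alpha_lt1 mV walk exV).
Qed.
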